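(* Let $\sigma(x)=\mathbf 1_{x>0}$ be the Heaviside function. Then: (M) for all $\mu\in\mathbb R$, $\nu>0$: $\displaystyle M_\sigma(\mu;\nu)=\Phi\!\left(\frac{\mu}{\sqrt\nu}\right)$; (K) for all $\mu_1,\mu_2\in\mathbb R$ and all positive semidefinite $\begin{pmatrix}\nu_{11}&\nu_{12}\\ \nu_{12}&\nu_{22}\end{pmatrix}$ with $\nu_{11},\nu_{22}>0$: $$K_\sigma(\mu_1,\mu_2;\nu_{11},\nu_{22},\nu_{12})=\Phi_2\!\left(\frac{\mu_1}{\sqrt{\nu_{11}}},\frac{\mu_2}{\sqrt{\nu_{22}}};\frac{\nu_{12}}{\sqrt{\nu_{11}\nu_{22}}}\right)-\Phi_2\!\left(\frac{\mu_1}{\sqrt{\nu_{11}}},\frac{\mu_2}{\sqrt{\nu_{22}}};0\right);$$ (L) for all $\mu_1\in\mathbb R$ and all positive semidefinite $\begin{pmatrix}\nu_{11}&\nu_{12}\\ \nu_{12}&\nu_{22}\end{pmatrix}$ with $\nu_{11}>0$: $$L_\sigma(\mu_1;\nu_{11},\nu_{22},\nu_{12})=\frac{\nu_{12}}{\sqrt{\nu_{11}}}\,\phi\!\left(\frac{\mu_1}{\sqrt{\nu_{11}}}\right).$$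
   Context: $\Phi$ and $\phi=\Phi'$ are the standard normal CDF and density. $\Phi_2(h,k;\rho)=\mathbb P[Z_1\le h,Z_2\le k]$ is the bivariate normal CDF, where $(Z_1,Z_2)$ is jointly normal with zero means, unit variances and correlation $\rho\in[-1,1]$. $M_\sigma(\mu;\nu):=\mathbb E\,\sigma(X)$ where $X\sim\mathcal N(\mu,\nu)$. For $(X_1,X_2)$ jointly normal with means $\mu_1,\mu_2$ and covariance matrix $\begin{pmatrix}\nu_{11}&\nu_{12}\\ \nu_{12}&\nu_{22}\end{pmatrix}$: $K_\sigma(\mu_1,\mu_2;\nu_{11},\nu_{22},\nu_{12}):=\operatorname{Cov}(\sigma(X_1),\sigma(X_2))$ and $L_\sigma(\mu_1;\nu_{11},\nu_{22},\nu_{12}):=\operatorname{Cov}(\sigma(X_1),X_2)$ (the latter does not depend on $\mu_2$). *)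

(* Defs.v *)
From HB Require Import structures.
From mathcomp Require Import all_boot all_order all_algebra.
From mathcomp Require Import all_classical all_reals all_analysis.

Set Implicit Arguments.
Unset Strict Implicit.
Unset Printing Implicit Defensive.

Import Order.TTheory GRing.Theory Num.Theory.
Import numFieldNormedType.Exports.

Local Open Scope classical_set_scope.
Local Open Scope ring_scope.

Definition heaviside (R : realType) (x : R) : R := (0 < x)%R%:R.

Definition Phi (R : realType) (x : R) : R :=
  fine (normal_prob (0 : R) 1 `]-oo, x]).

Definition phi (R : realType) (x : R) : R := normal_pdf (0 : R) 1 x.

(* All laws below are compared on measurable sets only: the library's measures
   are functions on all sets, with arbitrary values on non-measurable ones.
   [normal_prob] takes the standard deviation, whence the square root; it is
   only the normal law when [0 < nu]. *)
Definition normal_rv d (T : measurableType d) (R : realType)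
    (P : probability T R) (X : {RV P >-> R}) (mu nu : R) : Prop :=
  forall B, measurable B ->
    distribution P X B = normal_prob mu (Num.sqrt nu) B.

Definition covmx2 (R : realType) (nu11 nu22 nu12 : R) : 'M[R]_2 :=
  \matrix_(i, j) (if i == j then if i == 0 then nu11 else nu22 else nu12).

Definition psd_mx (R : realType) n (S : 'M[R]_n) : Prop :=
  S^T = S /\ forall v : 'rV[R]_n, 0 <= (v *m S *m v^T) 0 0.

(* [(mu1, mu2) + A z], with pairs read as column vectors *)
Definition affine2 (R : realType) (mu1 mu2 : R) (A : 'M[R]_2) (z : R * R) :
    R * R :=
  (mu1 + (A 0 0 * z.1 + A 0 1 * z.2), mu2 + (A 1 0 * z.1 + A 1 1 * z.2)).

(* The law of [(mu1, mu2) + A Z] for [Z] a pair of independent standard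
   normal variables *)
Definition gauss2 (R : realType) (mu1 mu2 : R) (A : 'M[R]_2) :
    set (R * R) -> \bar R :=
  pushforward (normal_prob (0 : R) 1 \x normal_prob (0 : R) 1)%E
    (affine2 mu1 mu2 A).

(* [(X1, X2)] is distributed as [(mu1, mu2) + A Z] for some square root [A] of
   the covariance matrix; degenerate covariance matrices are allowed. *)
Definition jointly_normal d (T : measurableType d) (R : realType)
    (P : probability T R) (X1 X2 : {RV P >-> R})
    (mu1 mu2 nu11 nu22 nu12 : R) : Prop :=
  exists2 A : 'M[R]_2, A *m A^T = covmx2 nu11 nu22 nu12 &
    forall B, measurable B ->
      pushforward P (fun w => (X1 w, X2 w)) B = gauss2 mu1 mu2 A B.

Definition corr_root (R : realType) (rho : R) : 'M[R]_2 :=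
  \matrix_(i, j) (if i == 0 then (j == 0)%:R
                  else if j == 0 then rho else Num.sqrt (1 - rho ^+ 2)).

Lemma corr_rootP (R : realType) (rho : R) : -1 <= rho <= 1 ->
  corr_root rho *m (corr_root rho)^T = covmx2 1 1 rho.
Proof.
move=> rho1; have s0 : 0 <= 1 - rho ^+ 2.
  by rewrite subr_ge0 -real_normK ?num_real // expr_le1 ?normr_ge0 // ler_norml.
apply/matrixP => i j; rewrite !mxE !big_ord_recl big_ord0 !mxE /=.
case: i => [[|[|i]]] i2 //; case: j => [[|[|j]]] j2 // ; rewrite !eqE /= ?(mul1r,mulr1,mul0r,mulr0,addr0,add0r) //.
by rewrite -!expr2 sqr_sqrtr // subrKC.
Qed.

(* [Z1] and [rho Z1 + sqrt (1 - rho^2) Z2] have correlation [rho]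
   (see [corr_rootP]). *)
Definition Phi2 (R : realType) (h k rho : R) : R :=
  fine (gauss2 0 0 (corr_root rho) (`]-oo, h] `*` `]-oo, k])).

(* Main.v *)
(* Both covariances reduce to integrals against the standard Gaussian measure of
   the plane. Its density is radial, hence it is invariant under orthogonal maps
   (two one-variable affine substitutions and Tonelli's theorem). The law of
   [mu + A Z] therefore depends on [A A^T] only, and [A] may be taken to be the
   opposite of the Cholesky factor: [X1 > 0] becomes [Z1 < mu1 / sqrt nu11].
   The formula for K is then a comparison of quadrants up to two null lines; the
   formula for L follows from the symmetry of the second coordinate and from
   [phi' x = - x * phi x]. *)

Require Import Defs.
From HB Require Import structures.
From mathcomp Require Import all_boot all_order all_algebra.
From mathcomp Require Import all_classical all_reals all_analysis.
From mathcomp Require Import measurable_realfun ring lra.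

Import Order.TTheory GRing.Theory Num.Theory.
Import numFieldNormedType.Exports.

Local Open Scope classical_set_scope.
Local Open Scope ring_scope.

Set Implicit Arguments.
Unset Strict Implicit.
Unset Printing Implicit Defensive.

(** * Affine change of variable for Lebesgue measure on the line *)

Section affine_substitution.
Context {R : realType}.
Notation leb := (@lebesgue_measure R).

Lemma measurable_affine (a b : R) :
  measurable_fun setT (fun x : measurableTypeR R => a * x + b : measurableTypeR R).
Proof. by apply: measurable_funD => //; exact: measurable_funM. Qed.

(** A negative slope reverses the order, so the half-open interval comes back closed on the left and
    open on the right. *)
Let affine_preimage_oc (a b c d : R) : a != 0 ->
  (fun x : R => a * x + b) @^-1` `]c, d] =
  if 0 < a then `](c - b) / a, (d - b) / a]%classic
  else `[(d - b) / a, (c - b) / a[%classic.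
Proof.
move=> a0; apply/seteqP; case: ifPn => [apos|aneg].
  split=> x /=; rewrite !in_itv/= ltr_pdivrMr// ler_pdivlMr//;
  by rewrite ltrBlDr lerBrDr mulrC.
have {}aneg : a < 0 by rewrite lt_neqAle a0 leNgt.
split=> x /=; rewrite !in_itv/= ltr_ndivlMr// ler_ndivrMr// ltrBlDr lerBrDr mulrC;
by move/andP=> [-> ->].
Qed.

(** By uniqueness of Lebesgue measure: the right-hand side is a measure, the pushforward under the
    affine map scaled by [|a|], and it gives each half-open interval its length. *)
Lemma lebesgue_measure_affine (a b : R) (A : set (measurableTypeR R)) :
  a != 0 -> measurable A ->
  (leb A = `|a|%:E * leb ((fun x : R => (a * x + b)%R) @^-1` A))%E.
Proof.
move=> a0 mA.
pose f (x : measurableTypeR R) : measurableTypeR R := a * x + b.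
have mf : measurable_fun setT f by exact: measurable_affine.
pose nm : {nonneg R} := NngNum (normr_ge0 a).
pose m0 : {measure set _ -> \bar R} := pushforward leb f.
transitivity (mscale nm (m0 mf) A); last by [].
apply: lebesgue_measure_unique => // X /ocitvP[->|[[c d]/= cd ->]].
  by rewrite !measure0.
rewrite /mscale/= /pushforward (affine_preimage_oc _ _ _ a0).
case: ifPn => [apos|aneg].
  rewrite !lebesgue_measure_itv/= !lte_fin cd ltr_pM2r ?invr_gt0// ltrD2r cd.
  by rewrite -!EFinB -EFinM gtr0_norm//; congr (_%:E); field.
have {}aneg : a < 0 by rewrite lt_neqAle a0 leNgt.
rewrite !lebesgue_measure_itv/= !lte_fin cd ltr_nM2r ?invr_lt0// ltrD2r cd.
by rewrite -!EFinB -EFinM ltr0_norm//; congr (_%:E); field.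
Qed.

Lemma ge0_integral_affine (a b : R) (f : measurableTypeR R -> \bar R) :
  a != 0 -> measurable_fun setT f -> (forall x, 0 <= f x)%E ->
  (\int[leb]_x f x = `|a|%:E * \int[leb]_x f (a * x + b)%R)%E.
Proof.
move=> a0 mf f0.
pose g (x : measurableTypeR R) : measurableTypeR R := a * x + b.
have mg : measurable_fun setT g by exact: measurable_affine.
pose nm : {nonneg R} := NngNum (normr_ge0 a).
pose m0 : {measure set _ -> \bar R} := pushforward leb g.
rewrite (eq_measure_integral (mscale nm (m0 mg))) => [|A mA _]; last first.
  exact: lebesgue_measure_affine.
by rewrite ge0_integral_mscale// ge0_integral_pushforward.
Qed.

End affine_substitution.

(** * One-dimensional normal laws: densities, affine images, null points *)

Section normal_law.
Context {R : realType}.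
Implicit Types m s a b x y : R.
Notation leb := (@lebesgue_measure R).
Notation G := (normal_prob (0 : R) 1).

(** The Radon-Nikodym derivative of [normal_prob m s] and [normal_pdf m s] have the same integral
    over every measurable set, hence agree almost everywhere. One may replace the other in the
    change of measure. *)
Lemma ge0_integral_normal_prob m s (f : measurableTypeR R -> \bar R) :
  measurable_fun setT f -> (forall x, 0 <= f x)%E ->
  (\int[normal_prob m s]_x f x = \int[leb]_x (f x * (normal_pdf m s x)%:E))%E.
Proof.
move=> mf f0; have dom := normal_prob_dominates m s.
rewrite -(Radon_Nikodym_SigmaFinite.change_of_variables dom f0 measurableT mf).
have intf := Radon_Nikodym_SigmaFinite.f_integrable dom.
have intp := integrable_normal_pdf m s.
apply: ae_eq_integral => //.
- by apply: emeasurable_funM => //; exact: measurable_int intf.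
- by apply: emeasurable_funM => //; exact: measurable_int intp.
- apply: ae_eqe_mul2l; apply: integral_ae_eq => //.
  + exact: measurable_int intp.
  + by move=> E _ mE; rewrite -Radon_Nikodym_SigmaFinite.f_integral.
Qed.

Lemma phiE x : phi x = normal_peak 1 * expR (- x ^+ 2 / 2).
Proof.
by rewrite /phi normal_pdfE ?oner_eq0// /normal_fun subr0 expr1n.
Qed.

Lemma phiN x : phi (- x) = phi x.
Proof. by rewrite !phiE sqrrN. Qed.

Lemma measurable_phi : measurable_fun setT (@phi R).
Proof. exact: measurable_normal_pdf. Qed.

Lemma phi_ge0 x : 0 <= phi x.
Proof. exact: normal_pdf_ge0. Qed.

Lemma normal_pdf_affine m s x : s != 0 ->
  `|s| * normal_pdf m s (s * x + m) = phi x.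
Proof.
move=> s0; rewrite phiE normal_pdfE// /normal_fun addrK /normal_peak expr1n mul1r.
rewrite mulrA -mulrnAr sqrtrM ?sqr_ge0// sqrtr_sqr invfM mulrA divff ?normr_eq0//.
rewrite mul1r exprMn; congr (_ * expR _); rewrite -mulr_natr.
by field.
Qed.

(** Substitution in the defining integral, the Jacobian [|s|] being absorbed by [normal_pdf_affine].
    Negative [s] is allowed on purpose: reflections of the line are obtained this way. *)
Lemma normal_prob_affine m s (B : set (measurableTypeR R)) :
  s != 0 -> measurable B ->
  normal_prob m s B = G ((fun x : R => s * x + m) @^-1` B).
Proof.
move=> s0 mB; rewrite /normal_prob.
rewrite integral_mkcond [RHS]integral_mkcond (ge0_integral_affine m s0); first last.
- move=> x; rewrite patchE; case: ifP => // _.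
  by rewrite lee_fin normal_pdf_ge0.
- apply/(measurable_restrictT _ mB)/measurable_funTS.
  by apply/measurable_EFinP; exact: measurable_normal_pdf.
rewrite -ge0_integralZl//.
- apply: eq_integral => x _.
  rewrite !patchE; case: ifPn => [|] xB.
    rewrite ifT; last by move: xB; rewrite !inE.
    by rewrite -EFinM normal_pdf_affine.
  rewrite ifF ?mule0//; apply/negbTE; move: xB; rewrite !notin_setE.
  exact.
- apply: (measurableT_comp (f := _ \_ B)); last exact: measurable_affine.
  apply/(measurable_restrictT _ mB)/measurable_funTS.
  by apply/measurable_EFinP; exact: measurable_normal_pdf.
- move=> x _; rewrite patchE; case: ifP => // _.
  by rewrite lee_fin normal_pdf_ge0.
Qed.

Lemma normal_prob1 m s x : normal_prob m s [set x] = 0%E.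
Proof.
have /null_content_dominatesP := normal_prob_dominates m s; apply=> //.
exact: lebesgue_measure_set1.
Qed.

End normal_law.

(** * Linear change of variables for Lebesgue measure on the plane *)

Section linear_substitution.
Context {R : realType}.
Implicit Types p q r t : R.
Notation leb := (@lebesgue_measure R).
Notation RR := (measurableTypeR R * measurableTypeR R)%type.
Notation lin2 p q r t :=
  (fun z : RR => (p * z.1 + q * z.2, r * z.1 + t * z.2) : RR).

Lemma measurable_lin2 p q r t : measurable_fun setT (lin2 p q r t).
Proof.
by apply: measurable_fun_pair; apply: measurable_funD; exact: measurable_funM.
Qed.

Lemma ge0_integral_swap (f : RR -> \bar R) :
  measurable_fun setT f -> (forall z, 0 <= f z)%E ->
  (\int[leb \x leb]_z f (z.2, z.1) = \int[leb \x leb]_z f z)%E.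
Proof.
move=> mf f0; rewrite fubini_tonelli1//; last first.
  by apply: (measurableT_comp mf); exact: measurable_fun_pair.
by rewrite fubini_tonelli2.
Qed.

(** The matrix is a product of two triangular ones. With [x] fixed, [y] is replaced by
    [D / p * y + r / p * x]; after exchanging the integrals, with [y] fixed, [x] is replaced by
    [p * x + q * y]. The composite is [lin2 p q r t], and the Jacobians multiply to [|D|]. *)
Let ge0_integral_lin2_neq0 p q r t (f : RR -> \bar R) :
  p != 0 -> p * t - q * r != 0 ->
  measurable_fun setT f -> (forall z, 0 <= f z)%E ->
  (\int[leb \x leb]_z f z =
   `|p * t - q * r|%:E * \int[leb \x leb]_z f (lin2 p q r t z))%E.
Proof.
move=> p0 D0 mf f0; set D := p * t - q * r in D0 *.
have Dp0 : D / p != 0 by rewrite mulf_neq0// invr_neq0.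
have mg : measurable_fun setT (fun z : RR => f (z.1, (D / p * z.2 + r / p * z.1)%R)).
  apply: (measurableT_comp mf); apply: measurable_fun_pair => //.
  by apply: measurable_funD; exact: measurable_funM.
have mh : measurable_fun setT (fun z : RR => f (lin2 p q r t z)).
  by apply: (measurableT_comp mf); exact: measurable_lin2.
rewrite fubini_tonelli1// (fubini_tonelli2 (fun z => f (lin2 p q r t z)))//.
transitivity (\int[leb]_x (`|D / p|%:E *
    \int[leb]_y f (x, (D / p * y + r / p * x)%R)))%E.
  apply: eq_integral => x _; rewrite /fubini_F.
  apply: (ge0_integral_affine (f := fun y => f (x, y)) (r / p * x) Dp0) => //.
  by apply: (measurableT_comp mf); exact: measurable_fun_pair.
rewrite ge0_integralZl; first last.
- exact: normr_ge0.
- by move=> x _; exact: integral_ge0.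
- exact: (measurable_fun_fubini_tonelli_F _ mg).
- exact: measurableT.
have fub := fubini_tonelli _ mg (fun z => f0 _).
rewrite [X in (_ * X)%E]fub.
transitivity (`|D / p|%:E * \int[leb]_y (`|p|%:E *
    \int[leb]_x f (lin2 p q r t (x, y))))%E.
  congr (_ * _)%E; apply: eq_integral => y _.
  rewrite [LHS](ge0_integral_affine (q * y) p0)//=; last first.
    apply: (measurableT_comp mf); apply: measurable_fun_pair => //.
    by apply: measurable_funD => //; exact: measurable_funM.
  congr (_ * _)%E; apply: eq_integral => x _; congr (f (_, _)).
  by rewrite /D; field.
rewrite ge0_integralZl; first last.
- exact: normr_ge0.
- by move=> x _; exact: integral_ge0.
- exact: (measurable_fun_fubini_tonelli_G _ mh).
- exact: measurableT.
by rewrite muleA -EFinM -normrM divfK.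
Qed.

Lemma ge0_integral_lin2 p q r t (f : RR -> \bar R) :
  p * t - q * r != 0 -> measurable_fun setT f -> (forall z, 0 <= f z)%E ->
  (\int[leb \x leb]_z f z =
   `|p * t - q * r|%:E * \int[leb \x leb]_z f (lin2 p q r t z))%E.
Proof.
move=> D0 mf f0; have [p0|] := eqVneq p 0; last first.
  by move=> p0; exact: ge0_integral_lin2_neq0.
(* With a zero pivot, exchanging the columns puts [q] in the pivot position; this only changes the
   sign of the determinant and swaps the integration variables. *)
have q0 : q != 0 by apply: contra_neq D0 => ->; rewrite p0; ring.
have D'0 : q * r - p * t != 0 by rewrite -oppr_eq0 opprB.
rewrite (ge0_integral_lin2_neq0 q0 D'0 mf f0) distrC; congr (_ * _)%E.
rewrite -ge0_integral_swap//; last first.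
  by apply: (measurableT_comp mf); exact: measurable_lin2.
by apply: eq_integral => z _ /=; rewrite ![_ * z.1 + _]addrC.
Qed.

End linear_substitution.

(** * Invariance of the standard Gaussian measure of the plane under orthogonal maps *)

Section gauss_plane.
Context {R : realType}.
Implicit Types p q r t : R.
Notation leb := (@lebesgue_measure R).
Notation G := (normal_prob (0 : R) 1).
Notation GG := (G \x G)%E.
Notation RR := (measurableTypeR R * measurableTypeR R)%type.
Notation lin2 p q r t :=
  (fun z : RR => (p * z.1 + q * z.2, r * z.1 + t * z.2) : RR).

Let measurable_gauss_integrand (f : RR -> \bar R) : measurable_fun setT f ->
  measurable_fun setT (fun z : RR => (f z * (phi z.1 * phi z.2)%:E)%E).
Proof.
move=> mf; apply: emeasurable_funM => //; apply/measurable_EFinP.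
by apply: measurable_funM; apply: (measurableT_comp measurable_phi).
Qed.

Lemma ge0_integral_gauss_plane (f : RR -> \bar R) :
  measurable_fun setT f -> (forall z, 0 <= f z)%E ->
  (\int[GG]_z f z = \int[leb \x leb]_z (f z * (phi z.1 * phi z.2)%:E))%E.
Proof.
move=> mf f0.
have mp := measurable_gauss_integrand mf.
rewrite fubini_tonelli1// [RHS]fubini_tonelli1//; last first.
  by move=> z; rewrite mule_ge0// lee_fin mulr_ge0// phi_ge0.
rewrite ge0_integral_normal_prob; last 2 first.
- exact: measurable_fun_fubini_tonelli_F.
- by move=> x; exact: integral_ge0.
apply: eq_integral => x _; rewrite /fubini_F ge0_integral_normal_prob//=; last first.
  by apply: (measurableT_comp mf); exact: measurable_fun_pair.
rewrite muleC -ge0_integralZl//; last 3 first.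
- apply: emeasurable_funM; first exact: measurableT_comp.
  by apply/measurable_EFinP; exact: measurable_normal_pdf.
- by move=> y _; rewrite mule_ge0// lee_fin normal_pdf_ge0.
- by rewrite lee_fin normal_pdf_ge0.
by apply: eq_integral => y _; rewrite EFinM /phi muleCA.
Qed.

(** The product density depends on [x ^+ 2 + y ^+ 2] only, which a matrix with orthonormal columns
    preserves. *)
Lemma phiM_orth p q r t x y :
  p ^+ 2 + r ^+ 2 = 1 -> q ^+ 2 + t ^+ 2 = 1 -> p * q + r * t = 0 ->
  phi (p * x + q * y) * phi (r * x + t * y) = phi x * phi y :> R.
Proof.
move=> h1 h2 h3; rewrite !phiE mulrACA [RHS]mulrACA -!expRD.
congr (_ * expR _); rewrite -!mulrDl; congr (_ / 2).
transitivity (- ((p ^+ 2 + r ^+ 2) * x ^+ 2 + (q ^+ 2 + t ^+ 2) * y ^+ 2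
  + 2 * (p * q + r * t) * (x * y))); first by ring.
by rewrite h1 h2 h3; ring.
Qed.

Lemma ge0_integral_gauss_plane_orth p q r t (f : RR -> \bar R) :
  p ^+ 2 + r ^+ 2 = 1 -> q ^+ 2 + t ^+ 2 = 1 -> p * q + r * t = 0 ->
  measurable_fun setT f -> (forall z, 0 <= f z)%E ->
  (\int[GG]_z f (lin2 p q r t z) = \int[GG]_z f z)%E.
Proof.
move=> h1 h2 h3 mf f0.
have D2 : (p * t - q * r) ^+ 2 = 1.
  (* Lagrange's identity for the two columns: the squared determinant is the product of the squared
     norms minus the squared inner product. *)
  transitivity ((p ^+ 2 + r ^+ 2) * (q ^+ 2 + t ^+ 2) - (p * q + r * t) ^+ 2).
    by ring.
  by rewrite h1 h2 h3; ring.
have D0 : p * t - q * r != 0 by rewrite -sqrf_eq0 D2 oner_eq0.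
have nD : `|p * t - q * r| = 1.
  by apply/eqP; rewrite -(@pexpr_eq1 _ _ 2)// -normrX D2 normr1.
have mp := measurable_gauss_integrand mf.
rewrite !ge0_integral_gauss_plane//; last first.
  by apply: (measurableT_comp mf); exact: measurable_lin2.
have fp0 (z : RR) : (0 <= f z * (phi z.1 * phi z.2)%:E)%E.
  by rewrite mule_ge0// lee_fin mulr_ge0// phi_ge0.
rewrite [RHS](ge0_integral_lin2 D0 mp fp0) nD mul1e.
by apply: eq_integral => z _ /=; rewrite phiM_orth.
Qed.

Lemma gauss_plane_orth p q r t (B : set RR) :
  p ^+ 2 + r ^+ 2 = 1 -> q ^+ 2 + t ^+ 2 = 1 -> p * q + r * t = 0 ->
  measurable B -> GG (lin2 p q r t @^-1` B) = GG B.
Proof.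
move=> h1 h2 h3 mB.
have mlB : measurable (lin2 p q r t @^-1` B).
  by rewrite -[_ @^-1` _]setTI; exact: measurable_lin2.
have m1B : measurable_fun setT (fun z : RR => (\1_B z : R)%:E).
  by apply/measurable_EFinP; exact: measurable_indic.
have B0 (z : RR) : (0 <= (\1_B z : R)%:E :> \bar R)%E by rewrite lee_fin.
have := ge0_integral_gauss_plane_orth h1 h2 h3 m1B B0.
rewrite [X in _ = X](integral_indic _ measurableT mB) setIT => <-.
by rewrite -[X in _ X = _]setIT -(integral_indic _ measurableT mlB).
Qed.

End gauss_plane.

(** * Linear images of the plane Gaussian and the Cholesky normal form *)

Section gauss2_law.
Context {R : realType}.
Implicit Types (mu nu rho tau s a b h k : R) (A : 'M[R]_2).
Notation G := (normal_prob (0 : R) 1).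
Notation GG := (G \x G)%E.
Notation RR := (measurableTypeR R * measurableTypeR R)%type.

(** A linear form with unit coefficient vector is standard normal: complete [(rho, tau)] to a
    rotation with second row [(- tau, rho)] and apply invariance to the strip [B] times the line.
    The case [tau = 0] is included, which later covers correlations [1] and [-1]. *)
Lemma gauss_plane_line rho tau (B : set (measurableTypeR R)) :
  rho ^+ 2 + tau ^+ 2 = 1 -> measurable B ->
  GG [set z : RR | B (rho * z.1 + tau * z.2)] = G B.
Proof.
move=> h mB; have mBT : measurable (B `*` [set: measurableTypeR R]).
  exact: measurableX.
have h1 : rho ^+ 2 + (- tau) ^+ 2 = 1 by rewrite sqrrN.
have h2 : tau ^+ 2 + rho ^+ 2 = 1 by rewrite addrC.
have h3 : rho * tau + - tau * rho = 0 by ring.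
have := gauss_plane_orth h1 h2 h3 mBT.
rewrite product_measure1E// [X in (_ * X)%E](probability_setT G) mule1 => <-.
by congr (GG _); apply/seteqP; split => z //= -[].
Qed.

Lemma gauss_plane_fst (B : set (measurableTypeR R)) :
  measurable B -> GG (fst @^-1` B) = G B.
Proof.
move=> mB; have h1 : (1 : R) ^+ 2 + 0 ^+ 2 = 1 by ring.
apply: etrans (gauss_plane_line h1 mB); congr (GG _).
by apply/funext => z /=; rewrite mul1r mul0r addr0.
Qed.

Lemma normal_prob_ltE h : G `]-oo, h[%classic = G `]-oo, h]%classic.
Proof.
rewrite -(@setUitv1 _ _ -oo%O h true)// measureU0//.
exact: normal_prob1.
Qed.

Lemma normal_prob_PhiE h : G `]-oo, h[%classic = (Phi h)%:E.
Proof. by rewrite normal_prob_ltE /Phi fineK// fin_num_measure. Qed.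

(** The linear part is the opposite of the lower triangular matrix with rows [(s, 0)] and [(a, b)].
    The minus signs turn positivity of a coordinate into an upper bound on a linear form in [z], as
    in the quadrants of [Phi2]. *)
Definition tri_map mu1 mu2 s a b (z : RR) : RR :=
  (mu1 - s * z.1, mu2 - (a * z.1 + b * z.2)).

Lemma measurable_tri_map mu1 mu2 s a b :
  measurable_fun setT (tri_map mu1 mu2 s a b).
Proof.
apply: measurable_fun_pair; apply: measurable_funB => //.
  exact: measurable_funM.
by apply: measurable_funD; exact: measurable_funM.
Qed.

Lemma covmx2_root A nu11 nu22 nu12 : A *m A^T = covmx2 nu11 nu22 nu12 ->
  [/\ A 0 0 ^+ 2 + A 0 1 ^+ 2 = nu11, A 1 0 ^+ 2 + A 1 1 ^+ 2 = nu22 &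
      A 0 0 * A 1 0 + A 0 1 * A 1 1 = nu12].
Proof.
move=> /matrixP AE; have := AE 0 0; have := AE 1 1; have := AE 0 1.
rewrite !mxE !big_ord_recl !big_ord0 !mxE /= !addr0.
have -> : lift ord0 ord0 = 1 :> 'I_2 by exact/val_inj.
by move=> -> -> ->.
Qed.

(** Cauchy-Schwarz for the rows of [A]: the gap is the square of the determinant of [A]. It bounds
    the correlation by one in absolute value. *)
Lemma covmx2_root_le A nu11 nu22 nu12 : A *m A^T = covmx2 nu11 nu22 nu12 ->
  nu12 ^+ 2 <= nu11 * nu22.
Proof.
move=> /covmx2_root[<- <- <-]; rewrite -subr_ge0.
have -> : forall a b c d : R, (a ^+ 2 + b ^+ 2) * (c ^+ 2 + d ^+ 2)
  - (a * c + b * d) ^+ 2 = (a * d - b * c) ^+ 2 by move=> *; ring.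
exact: sqr_ge0.
Qed.

(* Rotating the source plane so that the first row of the root [A] becomes
   [(- sqrt nu11, 0)] makes every root of the covariance matrix equal to the
   opposite of the Cholesky one. *)
Lemma gauss2_cholesky A mu1 mu2 nu11 nu22 nu12 (B : set RR) :
  A *m A^T = covmx2 nu11 nu22 nu12 -> 0 < nu11 -> measurable B ->
  let s := Num.sqrt nu11 in
  gauss2 mu1 mu2 A B =
  GG (tri_map mu1 mu2 s (nu12 / s) (Num.sqrt (nu22 - (nu12 / s) ^+ 2)) @^-1` B).
Proof.
move=> /covmx2_root[E11 E22 E12] n11 mB s.
have s0 : s != 0 by rewrite sqrtr_eq0 -ltNge.
have s2 : s ^+ 2 = nu11 by rewrite sqr_sqrtr// ltW.
set a0 := A 0 0 in E11 E12 *; set a1 := A 0 1 in E11 E12 *.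
set b0 := A 1 0 in E22 E12 *; set b1 := A 1 1 in E22 E12 *.
(* Up to sign, the lower right Cholesky entry is the determinant of [A] divided by [s]. *)
pose b := (a0 * b1 - a1 * b0) / s.
have -> : nu22 - (nu12 / s) ^+ 2 = b ^+ 2.
  rewrite /b !expr_div_n s2 -E11 -E22 -E12; field.
  by rewrite E11 gt_eqF.
rewrite sqrtr_sqr.
(* The sign of [b], taken to be [1] at [b = 0] so that [e ^+ 2 = 1] also for a degenerate covariance
   matrix. *)
pose e : R := if 0 <= b then 1 else -1.
have e2 : e ^+ 2 = 1 by rewrite /e; case: ifP => _; ring.
have -> : `|b| = e * b.
  rewrite /e; case: ifPn => [b0'|]; first by rewrite ger0_norm// mul1r.
  by rewrite -ltNge => b0'; rewrite ltr0_norm// mulN1r.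
(* The orthogonal matrix has as columns the opposite of the normalized first row of [A] and, up to
   the sign [e], its quarter turn. Multiplying [A] by it gives the rows [(- s, 0)] and
   [(- nu12 / s, - e * b)]. *)
have u1 : (a0 / s) ^+ 2 + (a1 / s) ^+ 2 = 1.
  by rewrite !expr_div_n s2 -mulrDl E11 divff// gt_eqF.
have h1 : (- (a0 / s)) ^+ 2 + (- (a1 / s)) ^+ 2 = 1 by rewrite !sqrrN.
have h2 : (e * (a1 / s)) ^+ 2 + (- (e * (a0 / s))) ^+ 2 = 1.
  by rewrite sqrrN !exprMn -mulrDr e2 mul1r -!exprMn addrC.
have h3 : - (a0 / s) * (e * (a1 / s)) + - (a1 / s) * (- (e * (a0 / s))) = 0.
  by ring.
have mA : measurable_fun setT (affine2 mu1 mu2 A : RR -> RR).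
  apply: measurable_fun_pair; apply: measurable_funD => //;
    by apply: measurable_funD; exact: measurable_funM.
have mAB : measurable ((affine2 mu1 mu2 A : RR -> RR) @^-1` B).
  by rewrite -[_ @^-1` _]setTI; exact: mA.
rewrite /gauss2 /pushforward -(gauss_plane_orth h1 h2 h3 mAB).
congr (GG _); rewrite -comp_preimage; congr (_ @^-1` B).
apply/funext => z; rewrite /= /affine2 /tri_map /= -/a0 -/a1 -/b0 -/b1 /b.
congr (_, _).
  have sE : a0 * (a0 / s) + a1 * (a1 / s) = s.
    by rewrite !mulrA -!expr2 -mulrDl E11 -s2 expr2 mulfK.
  by rewrite -[X in _ = _ - X * _]sE; ring.
by rewrite -E12; ring.
Qed.

End gauss2_law.

(** * Quadrant probabilities and the bivariate normal distribution function *)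

Section heaviside_moments.
Context {R : realType}.
Implicit Types (mu nu rho tau s a b h k : R).
Notation G := (normal_prob (0 : R) 1).
Notation GG := (G \x G)%E.
Notation RR := (measurableTypeR R * measurableTypeR R)%type.

Lemma heaviside_comp (T : Type) (X : T -> R) :
  @heaviside R \o X = \1_[set w | 0 < X w].
Proof.
apply/funext => w; rewrite /heaviside indicE /=.
suff -> : (w \in [set w | 0 < X w]) = (0 < X w) by [].
by apply/idP/idP; rewrite inE.
Qed.

(** [Phi2] is defined with closed quadrants, whereas strict positivity yields open ones. They differ
    inside two lines, each null because a unit linear form has a normal law, which has no atoms. *)
Lemma Phi2E h k rho : rho ^+ 2 <= 1 ->
  GG [set z : RR | z.1 < h /\ rho * z.1 + Num.sqrt (1 - rho ^+ 2) * z.2 < k] =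
  (Phi2 h k rho)%:E.
Proof.
move=> rho1; set tau := Num.sqrt _.
have rt : rho ^+ 2 + tau ^+ 2 = 1 by rewrite sqr_sqrtr ?subr_ge0// addrC subrK.
have ml : measurable_fun setT (fun z : RR => rho * z.1 + tau * z.2).
  by apply: measurable_funD; exact: measurable_funM.
have mpre (f : RR -> R) (i : interval R) :
    measurable_fun setT f -> measurable (f @^-1` [set` i]).
  by move=> mf; rewrite -[_ @^-1` _]setTI; apply: mf => //; exact: measurable_itv.
pose S (i j : interval R) : set RR :=
  fst @^-1` [set` i] `&` (fun z : RR => rho * z.1 + tau * z.2) @^-1` [set` j].
have mS i j : measurable (S i j) by apply: measurableI; exact: mpre.
have line0 c : GG ((fun z : RR => rho * z.1 + tau * z.2) @^-1` [set c]) = 0%E.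
  exact: etrans (gauss_plane_line rt (measurable_set1 c)) (normal_prob1 0 1 c).
have fst0 c : GG (fst @^-1` [set c]) = 0%E.
  apply: etrans (normal_prob1 0 1 c).
  exact: gauss_plane_fst (measurable_set1 c).
have mfst c : measurable ((fst : RR -> _) @^-1` [set c]).
  by rewrite -[_ @^-1` _]setTI; exact: measurable_fst.
have mline c : measurable ((fun z : RR => rho * z.1 + tau * z.2) @^-1` [set c]).
  by rewrite -[_ @^-1` _]setTI; exact: ml.
(* The two boundary lines: the closed quadrant lies in the open one together with [N]. *)
pose N : set RR := fst @^-1` [set h] `|`
  (fun z : RR => rho * z.1 + tau * z.2) @^-1` [set k].
have mN : measurable N by exact: measurableU.
have N0 : GG N = 0%E.
  exact: etrans (measureU0 (mfst h) (mline k) (line0 k)) (fst0 h).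
transitivity (GG (S `]-oo, h[ `]-oo, k[)).
  by congr (GG _); apply/seteqP; split => z; rewrite /S/= !in_itv/=.
have SE : affine2 0 0 (corr_root rho) @^-1` (`]-oo, h] `*` `]-oo, k]) =
    S `]-oo, h] `]-oo, k].
  apply/seteqP; split => z; rewrite /S/= /affine2 !mxE/= !in_itv/=;
    by rewrite !(mul1r, mul0r, add0r, addr0).
rewrite /Phi2 /gauss2 /pushforward SE fineK; last first.
  exact: (fin_num_measure (GG : probability _ R) _ (mS _ _)).
apply/eqP; rewrite eq_le; apply/andP; split.
  apply: le_measure; rewrite ?inE// => z.
  by rewrite /S/= !in_itv/= => -[/ltW ? /ltW ?].
apply: le_trans (_ : GG (S `]-oo, h[ `]-oo, k[ `|` N) <= _)%E; last first.
  by rewrite (measureU0 (mS _ _) mN N0).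
apply: le_measure; rewrite ?inE//; first exact: measurableU.
move=> z; rewrite /S/= !in_itv/= => -[].
rewrite le_eqVlt => /predU1P[zh _|zh]; first by right; left.
rewrite le_eqVlt => /predU1P[zk|zk]; first by right; right.
by left.
Qed.

End heaviside_moments.

(** * The mean of one Heaviside variable and the covariance of two *)

Section heaviside_covariance.
Context {R : realType} d (T : measurableType d) (P : probability T R).
Implicit Types (mu nu : R) (X : {RV P >-> R}).
Notation G := (normal_prob (0 : R) 1).
Notation GG := (G \x G)%E.
Notation RR := (measurableTypeR R * measurableTypeR R)%type.

Lemma Lfun1_indic (A : set T) : measurable A -> (\1_A : T -> R) \in Lfun P 1.
Proof. by move=> mA; apply/Lfun1_integrable; exact: integrable_indic. Qed.

Lemma covariance_indic (A B : set T) : measurable A -> measurable B ->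
  covariance P \1_A \1_B = (P (A `&` B) - P A * P B)%E.
Proof.
move=> mA mB; have mAB : measurable (A `&` B) by exact: measurableI.
have AB : (\1_A * \1_B)%R = \1_(A `&` B) :> (T -> R) by rewrite indicI.
by rewrite covarianceE ?AB ?Lfun1_indic// !expectation_indic.
Qed.

Lemma measurable_pos_RV X : measurable [set w | 0 < X w].
Proof.
rewrite [X in measurable X](_ : _ = X @^-1` `]0, +oo[%classic).
  exact: measurable_funPTI.
by apply/seteqP; split => w /=; rewrite in_itv/= andbT.
Qed.

Lemma expectation_heaviside X mu nu : 0 < nu -> normal_rv X mu nu ->
  'E_P[@heaviside R \o X]%E = (Phi (mu / Num.sqrt nu))%:E.
Proof.
move=> nu0 Xmu; have s0 : 0 < Num.sqrt nu by rewrite sqrtr_gt0.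
rewrite heaviside_comp expectation_indic; last exact: measurable_pos_RV.
have -> : [set w | 0 < X w] = X @^-1` `]0, +oo[%classic.
  by apply/seteqP; split => w /=; rewrite in_itv/= andbT.
rewrite -[LHS]/(distribution P X `]0, +oo[%classic) Xmu//.
(* The density depends on the standard deviation through its square only, so the opposite root may
   be used; the positive ray is then pulled back to the ray below [mu / Num.sqrt nu]. *)
have -> : normal_prob mu (Num.sqrt nu) = normal_prob mu (- Num.sqrt nu).
  apply/funext => B; rewrite /normal_prob; apply: eq_integral => x _.
  by rewrite /normal_pdf oppr_eq0 /normal_peak /normal_fun sqrrN.
rewrite normal_prob_affine ?oppr_eq0 ?gt_eqF// -normal_prob_PhiE.
congr (G _); apply/seteqP; split => x /=;
  by rewrite !in_itv/= andbT mulNr addrC subr_gt0 ltr_pdivlMr// mulrC.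
Qed.

Lemma jointly_normal_cholesky (X1 X2 : {RV P >-> R}) mu1 mu2 nu11 nu22 nu12
    (s := Num.sqrt nu11) (B : set RR) :
  jointly_normal X1 X2 mu1 mu2 nu11 nu22 nu12 -> 0 < nu11 -> measurable B ->
  P ((fun w => (X1 w, X2 w)) @^-1` B) =
  GG (tri_map mu1 mu2 s (nu12 / s) (Num.sqrt (nu22 - (nu12 / s) ^+ 2)) @^-1` B).
Proof.
move=> [A AE XE] n11 mB; rewrite -(gauss2_cholesky _ _ AE n11 mB) -XE//.
Qed.

(** The covariance is the probability that both variables are positive minus the product of the
    marginal probabilities. In Cholesky form the first is a quadrant of correlation [rho], and the
    product is the quadrant of correlation zero. *)
Lemma covariance_heaviside (X1 X2 : {RV P >-> R}) mu1 mu2 nu11 nu22 nu12 :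
  0 < nu11 -> 0 < nu22 ->
  jointly_normal X1 X2 mu1 mu2 nu11 nu22 nu12 ->
  covariance P (@heaviside R \o X1) (@heaviside R \o X2) =
  (Phi2 (mu1 / Num.sqrt nu11) (mu2 / Num.sqrt nu22)
        (nu12 / Num.sqrt (nu11 * nu22))
   - Phi2 (mu1 / Num.sqrt nu11) (mu2 / Num.sqrt nu22) 0)%:E.
Proof.
move=> n11 n22 XN; have [A AE _] := XN.
set s := Num.sqrt nu11; set r := Num.sqrt nu22.
have s0 : 0 < s by rewrite sqrtr_gt0.
have r0 : 0 < r by rewrite sqrtr_gt0.
have r2 : r ^+ 2 = nu22 by rewrite sqr_sqrtr// ltW.
have s2 : s ^+ 2 = nu11 by rewrite sqr_sqrtr// ltW.
have -> : Num.sqrt (nu11 * nu22) = s * r by rewrite sqrtrM// ltW.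
set rho := nu12 / (s * r); set h := mu1 / s; set k := mu2 / r.
have rho1 : rho ^+ 2 <= 1.
  rewrite expr_div_n exprMn s2 r2 ler_pdivrMr ?mulr_gt0// mul1r.
  exact: covmx2_root_le AE.
pose tau := Num.sqrt (1 - rho ^+ 2).
have rt : rho ^+ 2 + tau ^+ 2 = 1 by rewrite sqr_sqrtr ?subr_ge0// addrC subrK.
(* The second Cholesky row is [r] times [(rho, tau)], so dividing by [r] turns positivity of the
   second coordinate into the condition of [Phi2E]. *)
have aE : nu12 / s = r * rho by rewrite /rho; field; rewrite !gt_eqF.
have bE : Num.sqrt (nu22 - (nu12 / s) ^+ 2) = r * tau.
  rewrite aE exprMn r2 -{1}[nu22]mulr1 -mulrBr sqrtrM// ltW//.
have pos1 (z : R) : (0 < mu1 - s * z) = (z < h).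
  by rewrite subr_gt0 ltr_pdivlMr// mulrC.
have pos2 (z1 z2 : R) : (0 < mu2 - (r * rho * z1 + r * tau * z2)) =
    (rho * z1 + tau * z2 < k).
  rewrite subr_gt0 ltr_pdivlMr//; congr (_ < _); ring.
have law := jointly_normal_cholesky XN n11; rewrite bE aE in law.
have mpos : measurable [set x : measurableTypeR R | 0 < x].
  rewrite (_ : [set x | _] = `]0, +oo[%classic)//.
  by apply/seteqP; split => x /=; rewrite in_itv/= andbT.
have mposX (X : {RV P >-> R}) : measurable [set w | 0 < X w].
  exact: measurable_pos_RV.
have P1 : P [set w | 0 < X1 w] = (Phi h)%:E.
  rewrite -normal_prob_PhiE -gauss_plane_fst//.
  have -> : [set w | 0 < X1 w] =
      (fun w => (X1 w, X2 w)) @^-1` ([set x | 0 < x] `*` setT).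
    by apply/seteqP; split => w //= -[].
  rewrite law; last exact: measurableX.
  congr (GG _); apply/seteqP; split => z /=; rewrite in_itv/= pos1; first by case.
  by [].
have P2 : P [set w | 0 < X2 w] = (Phi k)%:E.
  rewrite -normal_prob_PhiE -(gauss_plane_line rt)//.
  have -> : [set w | 0 < X2 w] =
      (fun w => (X1 w, X2 w)) @^-1` (setT `*` [set x | 0 < x]).
    by apply/seteqP; split => w //= -[].
  rewrite law; last exact: measurableX.
  congr (GG _); apply/seteqP; split => z /=; rewrite in_itv/= pos2; first by case.
  by [].
have P12 : P ([set w | 0 < X1 w] `&` [set w | 0 < X2 w]) = (Phi2 h k rho)%:E.
  rewrite -Phi2E//.
  have -> : [set w | 0 < X1 w] `&` [set w | 0 < X2 w] =
      (fun w => (X1 w, X2 w)) @^-1` ([set x | 0 < x] `*` [set x | 0 < x]).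
    by apply/seteqP; split.
  rewrite law; last exact: measurableX.
  by congr (GG _); apply/seteqP; split => z /=; rewrite pos1 pos2.
(* At correlation zero the quadrant is a product of two rays, and the product measure factorizes. *)
have P0 : (Phi2 h k 0)%:E = ((Phi h)%:E * (Phi k)%:E)%E.
  have le01 : (0 : R) ^+ 2 <= 1 by rewrite expr0n ler01.
  have mlt x : measurable (`]-oo, x[%classic : set (measurableTypeR R)).
    exact: measurable_itv.
  have S0 : [set z : RR | z.1 < h /\
      0 * z.1 + Num.sqrt (1 - 0 ^+ 2) * z.2 < k] = `]-oo, h[ `*` `]-oo, k[.
    apply/seteqP; split => z /=;
      by rewrite expr0n subr0 sqrtr1 !in_itv/= mul0r mul1r add0r.
  have := Phi2E h k le01; rewrite S0 (product_measure1E G G (mlt h) (mlt k)).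
  by move=> <-; rewrite -(normal_prob_PhiE h) -(normal_prob_PhiE k).
rewrite !heaviside_comp (covariance_indic (mposX X1) (mposX X2)).
by rewrite P12 P1 P2 -P0 EFinB.
Qed.

End heaviside_covariance.

(** * First moment of the standard normal law on a right tail *)

Section gaussian_tail.
Context {R : realType}.
Implicit Types (a h x : R).
Notation leb := (@lebesgue_measure R).
Notation G := (normal_prob (0 : R) 1).

Lemma is_derive_phi x : is_derive x 1 (@phi R) (- x * phi x).
Proof.
have -> : @phi R = fun x => normal_peak 1 * expR (- x ^+ 2 / 2).
  by apply/funext => y; rewrite phiE.
by apply: is_derive_eq; rewrite /GRing.scale/=; field.
Qed.

Lemma cvg_phi_pinfty : phi x @[x --> +oo] --> (0 : R).
Proof.
have -> : @phi R = fun x => normal_peak 1 * expR (- (x ^+ 2 / 2)).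
  by apply/funext => y; rewrite phiE mulNr.
rewrite -(mulr0 (normal_peak 1)); apply: cvgM; first exact: cvg_cst.
apply: (@cvg_comp _ _ _ (fun x : R => x ^+ 2 / 2) (fun x => expR (- x))
  _ (pinfty_nbhs R)); last exact: cvgr_expR.
apply: gt0_cvgMly; first by rewrite invr_gt0.
exact: cvgr_expr2.
Qed.

(** Fundamental theorem of calculus on a half-line with antiderivative [- phi], which vanishes at
    infinity; [0 <= a] makes the integrand nonnegative. *)
Lemma integral_tail_phi a : 0 <= a ->
  (\int[leb]_(x in `[a, +oo[) (x * phi x)%:E = (phi a)%:E)%E.
Proof.
move=> a0; rewrite (@ge0_continuous_FTC2y _ _ (fun x => - phi x) a 0).
- by rewrite -EFinB sub0r opprK.
- by move=> x ax; rewrite mulr_ge0 ?phi_ge0// (le_trans a0).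
- apply: continuous_subspaceT => x; apply: cvgM; first exact: cvg_id.
  by apply: continuous_normal_pdf; rewrite oner_eq0.
- by rewrite -oppr0; apply: cvgN; exact: cvg_phi_pinfty.
- by move=> x _; apply: derivableN; have [] := is_derive_phi x.
- apply: cvgN; apply: cvg_at_right_filter.
  by apply: continuous_normal_pdf; rewrite oner_eq0.
- move=> x _; rewrite derive1E deriveN; last by have [] := is_derive_phi x.
  by have [_ ->] := is_derive_phi x; rewrite mulNr opprK.
Qed.

(** The function [|x| * phi x] is even, so its integral is twice the tail integral from [0], hence
    finite. *)
Lemma integrable_normal_id : G.-integrable setT (fun x => x%:E).
Proof.
apply/integrableP; split; first exact/measurable_EFinP.
have cf : continuous (fun x : R => `|x| * phi x).
  move=> x; apply: cvgM; first exact: norm_continuous.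
  by apply: continuous_normal_pdf; rewrite oner_eq0.
rewrite ge0_integral_normal_prob//; last first.
  by apply: measurableT_comp => //; exact/measurable_EFinP.
have -> : (\int[leb]_x (`|x%:E| * (normal_pdf 0 1 x)%:E) =
    \int[leb]_x (`|x| * phi x)%:E)%E by [].
rewrite ge0_symfun_integralT//.
- have -> : (\int[leb]_(x in [set x | (0 <= x)%R]) (`|x| * phi x)%:E =
      \int[leb]_(x in `[0%R, +oo[) (x * phi x)%:E)%E.
    rewrite -set_itvcy; apply: eq_integral => x.
    by rewrite inE/= in_itv/= andbT => x0; rewrite ger0_norm.
  by rewrite integral_tail_phi// -EFinM ltry.
- by move=> x; rewrite mulr_ge0// phi_ge0.
- by move=> x /=; rewrite normrN phiN.
Qed.

(** The flag [b] selects a closed or an open ray. Both occur later: the complement of an open left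
    ray is closed, its mirror image is open. *)
Lemma expectation_tail (b : bool) a : 0 <= a ->
  (\int[G]_x (\1_[set` Interval (BSide b a) +oo%O] x * x)%:E = (phi a)%:E)%E.
Proof.
move=> a0; set A := [set` _].
have mA : measurable A by exact: measurable_itv.
have A0 x : 0 <= \1_A x * x.
  rewrite indicE; case: (boolP (x \in A)); rewrite ?mul0r// mul1r inE /A/=.
  case: b {mA} @A => /=; rewrite in_itv/= andbT; first exact: le_trans.
  by move=> /ltW; exact: le_trans.
have mf : measurable_fun setT (fun x => (\1_A x * x)%:E).
  by apply/measurable_EFinP; apply: measurable_funM => //; exact: measurable_indic.
rewrite ge0_integral_normal_prob//.
rewrite -(integral_tail_phi a0).
transitivity (\int[leb]_(x in A) (x * phi x)%:E)%E.
  rewrite [RHS]integral_mkcond; apply: eq_integral => x _.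
  by rewrite patchE indicE; case: ifP => _; rewrite ?mul1r ?mul0r ?mul0e// -EFinM.
rewrite /A; case: b {A mA A0 mf} => //; apply: integral_itv_obnd_cbnd.
apply/measurable_EFinP/measurable_funTS; apply: measurable_funM => //.
exact: measurable_phi.
Qed.

End gaussian_tail.

(** * Expectations depend on the law only *)

Section transfer_of_laws.
Context {R : realType} d1 d2 d (T1 : measurableType d1) (T2 : measurableType d2)
  (E : measurableType d) (P : probability T1 R) (Q : probability T2 R)
  (V : T1 -> E) (W : T2 -> E).
Hypotheses (mV : measurable_fun setT V) (mW : measurable_fun setT W).
Hypothesis VW : forall B, measurable B -> P (V @^-1` B) = Q (W @^-1` B).

(** Both sides are the integral of [g] against the pushforward measure, and the two pushforwards
    agree on measurable sets. *)
Lemma ge0_integral_same_law (g : E -> \bar R) :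
  measurable_fun setT g -> (forall x, 0 <= g x)%E ->
  (\int[P]_x g (V x) = \int[Q]_x g (W x))%E.
Proof.
move=> mg g0.
have pV := ge0_integral_pushforward mV P measurableT mg (fun x _ => g0 x).
have pW := ge0_integral_pushforward mW Q measurableT mg (fun x _ => g0 x).
rewrite !preimage_setT in pV pW; rewrite -[LHS]pV -[RHS]pW.
by apply: eq_measure_integral => B mB _; exact: VW.
Qed.

(** The nonnegative case is applied to the absolute value for integrability, then to the positive
    and negative parts for the expectation. *)
Lemma expectation_same_law (f : E -> R) : measurable_fun setT f ->
  f \o W \in Lfun Q 1 -> f \o V \in Lfun P 1 /\ 'E_P[f \o V]%E = 'E_Q[f \o W]%E.
Proof.
move=> mf /Lfun1_integrable/integrableP[_ fW].
have mEf : measurable_fun setT (EFin \o f) by exact/measurable_EFinP.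
split.
  apply/Lfun1_integrable/integrableP; split.
    by apply/measurable_EFinP; exact: measurableT_comp.
  rewrite (ge0_integral_same_law (g := abse \o (EFin \o f)))//.
    exact: measurableT_comp.
  by move=> x; exact: abse_ge0.
rewrite unlock integralE [RHS]integralE.
rewrite (funepos_comp (EFin \o f) V) (funeneg_comp (EFin \o f) V).
rewrite (funepos_comp (EFin \o f) W) (funeneg_comp (EFin \o f) W).
congr (_ - _)%E.
  by apply: ge0_integral_same_law => //; exact: measurable_funepos.
by apply: ge0_integral_same_law => //; exact: measurable_funeneg.
Qed.

End transfer_of_laws.

(** * Symmetry and truncated mean of the standard normal law *)

Section gaussian_integration.
Context {R : realType}.
Implicit Types (a b h mu : R).
Notation G := (normal_prob (0 : R) 1).
Notation GG := (G \x G)%E.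
Notation RR := (measurableTypeR R * measurableTypeR R)%type.

Lemma Lfun1_normal_id : (idfun : measurableTypeR R -> R) \in Lfun G 1.
Proof. by apply/Lfun1_integrable; exact: integrable_normal_id. Qed.

Lemma Lfun1_indicM d (T : measurableType d) (P : probability T R) (A : set T)
    (f : T -> R) : measurable A -> f \in Lfun P 1 -> (\1_A * f)%R \in Lfun P 1.
Proof.
move=> mA /Lfun1_integrable If; apply/Lfun1_integrable.
have mf : measurable_fun setT f.
  by apply/measurable_EFinP; exact: measurable_int If.
apply: le_integrable If => //.
  by apply/measurable_EFinP; apply: measurable_funM => //; exact: measurable_indic.
move=> x _ /=; rewrite lee_fin normrM ler_piMl// indicE.
by case: (x \in A); rewrite ?normr1 ?normr0.
Qed.

Lemma normal_probN (B : set (measurableTypeR R)) : measurable B ->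
  G (-%R @^-1` B) = G B.
Proof.
move=> mB; have -> : G B = normal_prob 0 (-1) B.
  rewrite /normal_prob; apply: eq_integral => x _.
  by rewrite /normal_pdf oppr_eq0 /normal_peak /normal_fun sqrrN.
rewrite [RHS]normal_prob_affine ?oppr_eq0 ?oner_eq0//; congr (G _).
by apply/funext => x /=; rewrite mulN1r addr0.
Qed.

Lemma expectation_normalN (f : measurableTypeR R -> R) : measurable_fun setT f ->
  f \in Lfun G 1 ->
  f \o -%R \in Lfun G 1 /\ 'E_G[f \o -%R]%E = 'E_G[f]%E.
Proof.
move=> mf fG.
have mN : measurable_fun setT (-%R : measurableTypeR R -> measurableTypeR R) by [].
exact: (expectation_same_law mN (@measurable_id _ _ setT) normal_probN mf fG).
Qed.

(** By symmetry the mean equals its opposite; integrability makes it finite, hence zero. *)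
Lemma expectation_normal_id : 'E_G[idfun : measurableTypeR R -> R]%E = 0%E.
Proof.
have [_] := expectation_normalN (@measurable_id _ _ setT) Lfun1_normal_id.
have -> : idfun \o -%R = -1 \o* (idfun : measurableTypeR R -> R).
  by apply/funext => x /=; rewrite mulrN1.
rewrite expectationZl; last exact: Lfun1_normal_id.
have /fineK <- := expectation_fin_num Lfun1_normal_id.
by rewrite -EFinM => -[E0]; congr (_%:E); lra.
Qed.

(** Both cases reduce to a tail with nonnegative endpoint. For [0 <= h] the tail from [h] is
    subtracted from the zero mean; for [h < 0] the reflection of the line gives the tail from
    [- h]. *)
Lemma expectation_truncated_normal h :
  'E_G[\1_[set x : measurableTypeR R | (x < h)%R] * idfun]%E = (- phi h)%:E.
Proof.
have mi (i : interval R) : measurable ([set` i] : set (measurableTypeR R)).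
  exact: measurable_itv.
have LT (i : interval R) := Lfun1_indicM (mi i) Lfun1_normal_id.
have ET (b : bool) a : 0 <= a ->
    'E_G[\1_[set` Interval (BSide b a) +oo%O] * idfun]%E = (phi a)%:E.
  by move=> a0; rewrite unlock; exact: expectation_tail.
have [h0|h0] := leP 0 h.
  have -> : \1_[set x | x < h] * idfun =
      idfun \- (\1_`[h, +oo[ * idfun) :> (measurableTypeR R -> R).
    apply/funext => x; rewrite !fctE/= !indicE; case: (ltP x h) => xh.
      rewrite mem_set// memNset ?mul1r ?mul0r ?subr0//=.
      by rewrite in_itv/= andbT; apply/negP; rewrite -ltNge.
    rewrite memNset ?mem_set ?mul1r ?mul0r ?subrr//= ?in_itv/= ?andbT//.
    by apply/negP; rewrite -leNgt.
  rewrite (expectationB Lfun1_normal_id (LT _)) ET// expectation_normal_id.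
  by rewrite sub0e.
have mf : measurable_fun setT
    (\1_`]- h, +oo[ * idfun : measurableTypeR R -> R).
  by apply: measurable_funM; [exact: measurable_indic|exact: measurable_id].
have [LN EN] := expectation_normalN mf (LT _).
have -> : \1_[set x | x < h] * idfun =
    -1 \o* ((\1_`]- h, +oo[ * idfun) \o -%R) :> (measurableTypeR R -> R).
  apply/funext => x; rewrite !fctE/= !indicE.
  have -> : (x \in [set x | x < h]) = (- x \in `]- h, +oo[%classic).
    by apply/idP/idP; rewrite !inE/= in_itv/= andbT ltrN2.
  by rewrite mulrN1 mulrN opprK.
rewrite expectationZl// EN ET; last by rewrite oppr_ge0 ltW.
by rewrite phiN EFinN mulN1e.
Qed.

End gaussian_integration.

(** * Covariance of a Heaviside variable with a linear one *)

Section heaviside_linear_covariance.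
Context {R : realType}.
Implicit Types (a b h s : R).
Notation G := (normal_prob (0 : R) 1).
Notation GG := (G \x G)%E.
Notation RR := (measurableTypeR R * measurableTypeR R)%type.
Notation half_plane h := [set z : RR | (z.1 < h)%R].

Lemma gauss_plane_snd (B : set (measurableTypeR R)) :
  measurable B -> GG (snd @^-1` B) = G B.
Proof.
move=> mB; have h1 : (0 : R) ^+ 2 + 1 ^+ 2 = 1 by ring.
apply: etrans (gauss_plane_line h1 mB); congr (GG _).
by apply/funext => z /=; rewrite mul1r mul0r add0r.
Qed.

Lemma expectation_fst (f : measurableTypeR R -> R) : measurable_fun setT f ->
  f \in Lfun G 1 ->
  f \o fst \in Lfun GG 1 /\ 'E_GG[f \o (fst : RR -> _)]%E = 'E_G[f]%E.
Proof.
exact: (expectation_same_law (P := (GG : probability RR R)) measurable_fst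
  (@measurable_id _ _ setT) gauss_plane_fst).
Qed.

Lemma expectation_snd (f : measurableTypeR R -> R) : measurable_fun setT f ->
  f \in Lfun G 1 ->
  f \o snd \in Lfun GG 1 /\ 'E_GG[f \o (snd : RR -> _)]%E = 'E_G[f]%E.
Proof.
exact: (expectation_same_law (P := (GG : probability RR R)) measurable_snd
  (@measurable_id _ _ setT) gauss_plane_snd).
Qed.

Let Lfst : (fst : RR -> R) \in Lfun GG 1.
Proof. exact: (expectation_fst (@measurable_id _ _ setT) Lfun1_normal_id).1. Qed.

Let Lsnd : (snd : RR -> R) \in Lfun GG 1.
Proof. exact: (expectation_snd (@measurable_id _ _ setT) Lfun1_normal_id).1. Qed.

Let Efst : 'E_GG[(fst : RR -> R)]%E = 0%E.
Proof.
apply: etrans expectation_normal_id.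
exact: (expectation_fst (@measurable_id _ _ setT) Lfun1_normal_id).2.
Qed.

Let Esnd : 'E_GG[(snd : RR -> R)]%E = 0%E.
Proof.
apply: etrans expectation_normal_id.
exact: (expectation_snd (@measurable_id _ _ setT) Lfun1_normal_id).2.
Qed.

Let mray h : measurable [set x : measurableTypeR R | x < h].
Proof.
rewrite (_ : [set x | _] = `]-oo, h[%classic); first exact: measurable_itv.
by apply/seteqP; split => x /=; rewrite in_itv.
Qed.

Let mhalf h : measurable (half_plane h).
Proof.
rewrite -[X in measurable X]setTI.
exact: (@measurable_fst _ _ (measurableTypeR R) (measurableTypeR R)
  measurableT _ (mray h)).
Qed.

Lemma gauss_half_plane h : GG (half_plane h) = (Phi h)%:E.
Proof.
rewrite -normal_prob_PhiE -gauss_plane_fst; last exact: measurable_itv.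
by congr (GG _); apply/seteqP; split => z /=; rewrite in_itv.
Qed.

Lemma expectation_half_plane_fst h :
  'E_GG[\1_(half_plane h) * (fst : RR -> R)]%E = (- phi h)%:E.
Proof.
rewrite -expectation_truncated_normal.
have Lf := Lfun1_indicM (mray h) Lfun1_normal_id.
have mf : measurable_fun setT
    (\1_[set x : measurableTypeR R | (x < h)%R] * idfun : measurableTypeR R -> R).
  apply: measurable_funM; last exact: measurable_id.
  exact: measurable_indic (mray h).
exact: (expectation_fst mf Lf).2.
Qed.

(** Reflecting the second coordinate preserves the Gaussian measure and the half-plane but changes
    the sign of the integrand, so the finite expectation equals its opposite. *)
Lemma expectation_half_plane_snd h :
  'E_GG[\1_(half_plane h) * (snd : RR -> R)]%E = 0%E.
Proof.
set f : RR -> R := \1_(half_plane h) * snd.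
have Lf : f \in Lfun GG 1 := Lfun1_indicM (mhalf h) Lsnd.
have mf : measurable_fun setT f.
  apply: measurable_funM; last exact: measurable_snd.
  exact: measurable_indic (mhalf h).
have law (B : set RR) : measurable B ->
    GG ((fun z : RR => (1 * z.1 + 0 * z.2, 0 * z.1 + -1 * z.2) : RR) @^-1` B) =
    GG (idfun @^-1` B).
  by move=> mB; apply: gauss_plane_orth mB; ring.
have [_] := expectation_same_law (P := (GG : probability RR R))
  (Q := (GG : probability RR R)) (measurable_lin2 1 0 0 (-1))
  (@measurable_id _ _ setT) law mf Lf.
rewrite [X in expectation _ X](_ : _ = -1 \o* f); last first.
  apply/funext => z; rewrite /f !fctE/= !indicE/=.
  have -> : (((1 * z.1 + 0 * z.2, 0 * z.1 + -1 * z.2) : RR) \in half_plane h) =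
      (z \in half_plane h).
    by apply/idP/idP; rewrite !inE/= mul1r mul0r addr0.
  ring.
rewrite (expectationZl _ Lf); have /fineK <- := expectation_fin_num Lf.
by rewrite -EFinM => -[E0]; congr (_%:E); lra.
Qed.

(** In Cholesky form the second variable is [mu2 - (a * z.1 + b * z.2)] and the first is positive on
    the half-plane [z.1 < h]. The [mu2] terms cancel, the [b] term has mean zero on the half-plane,
    and the [a] term contributes [- a * - phi h]. *)
Lemma covariance_heaviside_linear d (T : measurableType d) (P : probability T R)
    (X1 X2 : {RV P >-> R}) (mu1 mu2 nu11 nu22 nu12 : R) :
  0 < nu11 -> jointly_normal X1 X2 mu1 mu2 nu11 nu22 nu12 ->
  covariance P (@heaviside R \o X1) X2 =
  (nu12 / Num.sqrt nu11 * phi (mu1 / Num.sqrt nu11))%:E.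
Proof.
move=> n11 XN; have s0 : 0 < Num.sqrt nu11 by rewrite sqrtr_gt0.
have law B mB := jointly_normal_cholesky (B := B) XN n11 mB.
move: law; set s := Num.sqrt nu11 in s0 *; set a := nu12 / s.
set b := Num.sqrt (_ - _); set h := mu1 / s => law.
have mX : measurable_fun setT (fun w => (X1 w, X2 w) : RR).
  exact: measurable_fun_pair (measurable_funPT X1) (measurable_funPT X2).
have tr := expectation_same_law (Q := (GG : probability RR R)) mX
  (measurable_tri_map mu1 mu2 s a b) law.
pose H : RR -> R := \1_[set x : RR | 0 < x.1].
have mpos : measurable [set x : RR | 0 < x.1].
  rewrite [X in measurable X](_ : _ = fst @^-1` `]0%R, +oo[%classic).
    rewrite -[X in measurable X]setTI.
    by apply: measurable_fst => //; exact: measurable_itv.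
  by apply/seteqP; split => x /=; rewrite in_itv/= andbT.
have mH : measurable_fun setT H by exact: measurable_indic mpos.
have HW : H \o tri_map mu1 mu2 s a b = \1_(half_plane h).
  apply/funext => z; rewrite /H /= !indicE; congr (_%:R : R).
  suff -> : (tri_map mu1 mu2 s a b z \in [set x : RR | 0 < x.1]) =
    (z \in half_plane h) by [].
  by apply/idP/idP; rewrite !inE/= subr_gt0 ltr_pdivlMr// mulrC.
have L1 : \1_(half_plane h) \in Lfun GG 1 := Lfun1_indic _ (mhalf h).
have Lf1 : \1_(half_plane h) * (fst : RR -> R) \in Lfun GG 1.
  exact: Lfun1_indicM (mhalf h) Lfst.
have Lf2 : \1_(half_plane h) * (snd : RR -> R) \in Lfun GG 1.
  exact: Lfun1_indicM (mhalf h) Lsnd.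
have sndW : snd \o tri_map mu1 mu2 s a b =
    cst mu2 \- (a \o* (fst : RR -> R) \+ b \o* (snd : RR -> R)).
  apply/funext => z /=; rewrite (mulrC a) (mulrC b) //.
have HsndW : (H * snd) \o tri_map mu1 mu2 s a b =
    mu2 \o* \1_(half_plane h) \-
      (a \o* (\1_(half_plane h) * (fst : RR -> R)) \+
       b \o* (\1_(half_plane h) * (snd : RR -> R))).
  apply/funext => z; transitivity ((H \o tri_map mu1 mu2 s a b) z *
    (snd \o tri_map mu1 mu2 s a b) z); first by [].
  by rewrite HW sndW /= !fctE; ring.
(* Integrability and expectation of both factors and of their product are carried over from the
   Gaussian plane. *)
have [|LX1 EX1] := tr H mH; first by rewrite HW.
have [|LX2 EX2] := tr snd measurable_snd.
  by rewrite sndW rpredB ?rpredD ?Lfun_scale ?Lfun_cst.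
have [||LX12 EX12] := tr (H * snd).
- by apply: measurable_funM => //; exact: measurable_snd.
- by rewrite HsndW rpredB ?rpredD ?Lfun_scale.
have -> : @heaviside R \o X1 = H \o (fun w => (X1 w, X2 w)).
  by rewrite heaviside_comp.
have -> : covariance P (H \o (fun w => (X1 w, X2 w))) X2 = covariance P
  (H \o (fun w => (X1 w, X2 w))) (snd \o (fun w => (X1 w, X2 w))) by [].
rewrite (covarianceE LX1 LX2 LX12) EX1 EX2.
rewrite [X in ('E_P[X] - _)%E](_ : _ = (H * snd) \o (fun w => (X1 w, X2 w)))//.
rewrite EX12 HW sndW HsndW.
rewrite !expectationB ?expectationD ?expectationZl ?rpredD ?Lfun_scale ?Lfun_cst//.
have E1 : 'E_GG[\1_(half_plane h)]%E = (Phi h)%:E.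
  exact: etrans (expectation_indic _ (mhalf h)) (gauss_half_plane h).
rewrite expectation_cst E1 Efst Esnd.
rewrite expectation_half_plane_fst expectation_half_plane_snd.
rewrite !mule0 !adde0 ?sube0 -!EFinM -!EFinB; congr (_%:E).
by ring.
Qed.

End heaviside_linear_covariance.

Unset Implicit Arguments.

Theorem lemmaF1 (R : realType) :
  (* (M) *)
  (forall (d : measure_display) (T : measurableType d) (P : probability T R)
     (X : {RV P >-> R}) (mu nu : R),
     0 < nu ->
     normal_rv X mu nu ->
     'E_P[@heaviside R \o X]%E = (Phi (mu / Num.sqrt nu))%:E) /\
  (* (K) *)
  (forall (d : measure_display) (T : measurableType d) (P : probability T R)
     (X1 X2 : {RV P >-> R}) (mu1 mu2 nu11 nu22 nu12 : R),
     psd_mx (covmx2 nu11 nu22 nu12) ->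
     0 < nu11 -> 0 < nu22 ->
     jointly_normal X1 X2 mu1 mu2 nu11 nu22 nu12 ->
     covariance P (@heaviside R \o X1) (@heaviside R \o X2) =
     (Phi2 (mu1 / Num.sqrt nu11) (mu2 / Num.sqrt nu22)
           (nu12 / Num.sqrt (nu11 * nu22))
      - Phi2 (mu1 / Num.sqrt nu11) (mu2 / Num.sqrt nu22) 0)%:E) /\
  (* (L) *)
  (forall (d : measure_display) (T : measurableType d) (P : probability T R)
     (X1 X2 : {RV P >-> R}) (mu1 mu2 nu11 nu22 nu12 : R),
     psd_mx (covmx2 nu11 nu22 nu12) ->
     0 < nu11 ->
     jointly_normal X1 X2 mu1 mu2 nu11 nu22 nu12 ->
     covariance P (@heaviside R \o X1) X2 =
     (nu12 / Num.sqrt nu11 * phi (mu1 / Num.sqrt nu11))%:E).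
Proof.
split; [|split].
- by move=> d T P X mu nu nu0; exact: expectation_heaviside.
- by move=> d T P X1 X2 mu1 mu2 nu11 nu22 nu12 _; exact: covariance_heaviside.
- move=> d T P X1 X2 mu1 mu2 nu11 nu22 nu12 _.
  exact: covariance_heaviside_linear.
Qed.
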